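(* Let $R$ be an associative ring with identity and $n\ge 1$. Every finitely generated $n$-SG-projective left $R$-module is finitely presented and $n$-SG-flat.
   Context: $\mathrm{Mod}\,R$ (resp. $\mathrm{Mod}\,R^{op}$) is the category of left (resp. right) $R$-modules. For a positive integer $n$, a module $M\in \mathrm{Mod}\,R$ is called $n$-strongly Gorenstein projective ($n$-SG-projective) if there exists an exact sequence $0\to M\to P_{n-1}\to\cdots\to P_0\to M\to 0$ in $\mathrm{Mod}\,R$ with $P_i$ projective for all $0\le i\le n-1$, which remains exact after applying $\mathrm{Hom}_R(-,P)$ for every projective $P\in\mathrm{Mod}\,R$. A module $M\in \mathrm{Mod}\,R$ is called $n$-strongly Gorenstein flat ($n$-SG-flat) if there exists an exact sequence $0\to M\to F_{n-1}\to\cdots\to F_0\to M\to 0$ in $\mathrm{Mod}\,R$ with $F_i$ flat for all $0\le i\le n-1$, which remains exact after applying $I\otimes_R-$ for every injective $I\in\mathrm{Mod}\,R^{op}$. *)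

(* Defs.v *)
From HB Require Import structures.
From mathcomp Require Import all_boot all_order all_algebra.
From mathcomp.classical Require Import boolp.
From mathcomp.multinomials Require Import freeg.

Set Implicit Arguments.
Unset Strict Implicit.
Unset Printing Implicit Defensive.

Import GRing.Theory.
Local Open Scope ring_scope.
Local Open Scope quotient_scope.

(** Conventions. [R : pzRingType] is an arbitrary associative ring with identity
    (the zero ring is allowed).  A left R-module is an [lmodType R].  A right
    R-module is an [lmodType R^c], where [R^c] is the opposite ring: [x . a] is
    [(a : R^c) *: x]. *)

Section TensorProduct.
Variables (R : pzRingType) (I : lmodType R^c) (M : lmodType R).

Local Notation formal := {freeg (I * M)%type / int}.

(* The subgroup of the free abelian group on [I * M] that is killed in
   [I (x)_R M]. *)
Inductive tensor_null : formal -> Prop :=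
| tensor_null0 : tensor_null 0
| tensor_nullB u v : tensor_null u -> tensor_null v -> tensor_null (u - v)
| tensor_nullDl x x' y :
    tensor_null (<<(x + x', y)>> - (<<(x, y)>> + <<(x', y)>>))
| tensor_nullDr x y y' :
    tensor_null (<<(x, y + y')>> - (<<(x, y)>> + <<(x, y')>>))
| tensor_nullM x (a : R) y :
    tensor_null (<<((a : R^c) *: x, y)>> - <<(x, a *: y)>>).

Definition tensor_null_pred : {pred formal} := fun u => `[< tensor_null u >].

Lemma tensor_null_zmod_closed : zmod_closed tensor_null_pred.
Proof.
split; first by apply/asboolP; exact: tensor_null0.
by move=> u v /asboolP hu /asboolP hv; apply/asboolP; exact: tensor_nullB.
Qed.

HB.instance Definition _ :=
  GRing.isZmodClosed.Build formal tensor_null_pred tensor_null_zmod_closed.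

Definition tensor : zmodType := Quotient.quot tensor_null_pred.

Definition tens (x : I) (y : M) : tensor := \pi_tensor (<<(x, y)>> : formal).

Definition balanced (G : zmodType) (b : I -> M -> G) : Prop :=
  [/\ forall x x' y, b (x + x') y = b x y + b x' y,
      forall x y y', b x (y + y') = b x y + b x y' &
      forall x (a : R) y, b ((a : R^c) *: x) y = b x (a *: y)].

(* [zmodule G] is [G] as a module over [int]. *)
Definition tensor_lift (G : zmodType) (b : I -> M -> G) (t : tensor) : G :=
  fglift (fun p : I * M => b p.1 p.2 : zmodule G) (repr t).

Lemma pi_tensor_eq (u v : formal) :
  tensor_null (u - v) -> \pi_tensor u = \pi_tensor v.
Proof.
move=> h; apply/eqP; rewrite -[_ == _]Quotient.idealrBE.
by apply/asboolP.
Qed.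

Lemma pi_tensor_inj (u v : formal) :
  \pi_tensor u = \pi_tensor v -> tensor_null (u - v).
Proof. by move/eqP; rewrite -Quotient.idealrBE => /asboolP. Qed.

Lemma pi_tensorB (u v : formal) :
  \pi_tensor (u - v) = \pi_tensor u - \pi_tensor v.
Proof. exact: (raddfB \pi_tensor). Qed.

Lemma pi_tensorD (u v : formal) :
  \pi_tensor (u + v) = \pi_tensor u + \pi_tensor v.
Proof. exact: (raddfD \pi_tensor). Qed.

Lemma tens_balanced : balanced tens.
Proof.
rewrite /tens; split=> [x x' y|x y y'|x a y]; rewrite -?pi_tensorD.
- exact/pi_tensor_eq/tensor_nullDl.
- exact/pi_tensor_eq/tensor_nullDr.
- exact/pi_tensor_eq/tensor_nullM.
Qed.

Section UniversalProperty.
Variables (G : zmodType) (b : I -> M -> G).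
Hypothesis bP : balanced b.

Let lft (u : formal) : G := fglift (fun p : I * M => b p.1 p.2 : zmodule G) u.

Let lftB u v : lft (u - v) = lft u - lft v.
Proof. exact: (@lift_is_additive _ _ (zmodule G) _ u v). Qed.

Let lft0 : lft 0 = 0.
Proof. by rewrite -[X in lft X](subrr (0 : formal)) lftB subrr. Qed.

Let lftD u v : lft (u + v) = lft u + lft v.
Proof. by rewrite -[v in LHS]opprK lftB -[- v]sub0r lftB lft0 sub0r opprK. Qed.

Let lftU x y : lft <<(x, y)>> = b x y.
Proof. by rewrite /lft liftU scale1r. Qed.

Let lft_null u : tensor_null u -> lft u = 0.
Proof.
have [bDl bDr bM] := bP.
elim=> {u} [|u v _ hu _ hv|x x' y|x y y'|x a y].
- exact: lft0.
- by rewrite lftB hu hv subrr.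
- by rewrite lftB lftD !lftU bDl subrr.
- by rewrite lftB lftD !lftU bDr subrr.
- by rewrite lftB !lftU bM subrr.
Qed.

Let tensor_lift_pi u : tensor_lift b (\pi_tensor u) = lft u.
Proof.
apply/eqP; rewrite -subr_eq0 -lftB; apply/eqP/lft_null/pi_tensor_inj.
by rewrite reprK.
Qed.

Lemma tensor_liftB : {morph tensor_lift b : s t / s - t}.
Proof.
move=> s t; rewrite -[s]reprK -[t]reprK -pi_tensorB !tensor_lift_pi.
exact: lftB.
Qed.

Lemma tensor_liftE x y : tensor_lift b (tens x y) = b x y.
Proof. by rewrite tensor_lift_pi lftU. Qed.

End UniversalProperty.

Lemma tensor_eq_additive (G : zmodType) (f g : {additive tensor -> G}) :
  (forall x y, f (tens x y) = g (tens x y)) -> f =1 g.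
Proof.
move=> fg t; rewrite -[t]reprK; move: (repr t) => u.
rewrite -(freeg_sumE u) !raddf_sum; apply: eq_bigr => -[x y] _.
set k := coeff _ _; have -> : <<k *g (x, y)>> = <<(x, y)>> *~ k :> formal.
  by rewrite freegU_mulz intz.
by rewrite !raddfMz [f _]fg.
Qed.

End TensorProduct.

Definition tensor_map (R : pzRingType) (I J : lmodType R^c) (M N : lmodType R)
    (f : {linear I -> J}) (g : {linear M -> N}) : tensor I M -> tensor J N :=
  tensor_lift (fun x y => tens (f x) (g y)).

Lemma tensor_map_balanced (R : pzRingType) (I J : lmodType R^c)
    (M N : lmodType R) (f : {linear I -> J}) (g : {linear M -> N}) :
  balanced (fun x y => tens (f x) (g y)).
Proof.
have [tDl tDr tM] := @tens_balanced R J N.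
by split=> *; rewrite ?linearD ?linearZ /= ?tDl ?tDr ?tM.
Qed.

Lemma tensor_mapE (R : pzRingType) (I J : lmodType R^c) (M N : lmodType R)
    (f : {linear I -> J}) (g : {linear M -> N}) x y :
  tensor_map f g (tens x y) = tens (f x) (g y).
Proof. exact/tensor_liftE/tensor_map_balanced. Qed.

Lemma tensor_mapB (R : pzRingType) (I J : lmodType R^c) (M N : lmodType R)
    (f : {linear I -> J}) (g : {linear M -> N}) :
  {morph tensor_map f g : s t / s - t}.
Proof. exact/tensor_liftB/tensor_map_balanced. Qed.

(* Exactness at [B] of [A -f-> B -g-> C]. *)
Definition exact_at (A B C : zmodType) (f : A -> B) (g : B -> C) : Prop :=
  forall y, g y = 0 <-> exists x, f x = y.

(* Exactness of
     0 -> X_(n+1) -d_n-> X_n -> ... -> X_1 -d_0-> X_0 -> 0;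
   the [X_k] with [k > n.+1] and the [d_k] with [k > n] are irrelevant. *)
Definition exact_seq (n : nat) (X : nat -> zmodType)
    (d : forall k, X k.+1 -> X k) : Prop :=
  [/\ forall y, exists x, d 0%N x = y,
      forall k, (k < n)%N -> exact_at (d k.+1) (d k) &
      injective (d n)].

(* Exactness of the sequence of abelian groups
     0 -> Hom(X_0,Q) -> Hom(X_1,Q) -> ... -> Hom(X_(n+1),Q) -> 0
   whose maps are the precompositions with the [d_k]. *)
Definition hom_exact_seq (R : pzRingType) (n : nat) (X : nat -> lmodType R)
    (d : forall k, {linear X k.+1 -> X k}) (Q : lmodType R) : Prop :=
  [/\ forall h h' : {linear X 0%N -> Q}, h \o d 0%N =1 h' \o d 0%N -> h =1 h',
      forall k, (k < n)%N -> forall h : {linear X k.+1 -> Q},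
        h \o d k.+1 =1 (fun=> 0) <->
        exists h' : {linear X k -> Q}, h' \o d k =1 h &
      forall h : {linear X n.+1 -> Q},
        exists h' : {linear X n -> Q}, h' \o d n =1 h].

(* Exactness of [0 -> I (x) X_(n+1) -> ... -> I (x) X_0 -> 0]. *)
Definition tensor_exact_seq (R : pzRingType) (n : nat) (X : nat -> lmodType R)
    (d : forall k, {linear X k.+1 -> X k}) (I : lmodType R^c) : Prop :=
  exact_seq (X := fun k => tensor I (X k)) n (fun k => tensor_map idfun (d k)).

Definition projective (R : pzRingType) (P : lmodType R) : Prop :=
  forall (A B : lmodType R) (f : {linear A -> B}) (g : {linear P -> B}),
    (forall y, exists x, f x = y) -> exists h : {linear P -> A}, f \o h =1 g.

(* Stated over an arbitrary ring [S]; used below with [S := R^c]. *)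
Definition injective_module (S : pzRingType) (E : lmodType S) : Prop :=
  forall (A B : lmodType S) (f : {linear A -> B}) (g : {linear A -> E}),
    injective f -> exists h : {linear B -> E}, h \o f =1 g.

(* The functor [- (x)_R M] is exact. *)
Definition flat (R : pzRingType) (M : lmodType R) : Prop :=
  forall (A B C : lmodType R^c) (f : {linear A -> B}) (g : {linear B -> C}),
    exact_at f g ->
    exact_at (tensor_map f (idfun : {linear M -> M})) (tensor_map g idfun).

Definition finitely_generated (R : pzRingType) (M : lmodType R) : Prop :=
  exists (m : nat) (e : 'I_m -> M),
    forall x, exists a : 'I_m -> R, x = \sum_i a i *: e i.

(* There is an exact sequence [R^p -> R^m -> M -> 0]. *)
Definition finitely_presented (R : pzRingType) (M : lmodType R) : Prop :=
  exists (p m : nat) (f : {linear 'rV[R]_p -> 'rV[R]_m})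
         (g : {linear 'rV[R]_m -> M}),
    exact_at f g /\ forall y, exists x, g x = y.

(* In both definitions the sequence [0 -> M -> P_(n-1) -> ... -> P_0 -> M -> 0]
   is [0 -> X_(n+1) -> X_n -> ... -> X_1 -> X_0 -> 0], so that [P_i = X_(i+1)]. *)
Definition SG_projective (R : pzRingType) (n : nat) (M : lmodType R) : Prop :=
  exists (X : nat -> lmodType R) (d : forall k, {linear X k.+1 -> X k}),
    [/\ X 0%N = M /\ X n.+1 = M,
        forall i, (i < n)%N -> projective (X i.+1),
        exact_seq n (fun k => d k) &
        forall Q : lmodType R, projective Q -> hom_exact_seq n d Q].

Definition SG_flat (R : pzRingType) (n : nat) (M : lmodType R) : Prop :=
  exists (X : nat -> lmodType R) (d : forall k, {linear X k.+1 -> X k}),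
    [/\ X 0%N = M /\ X n.+1 = M,
        forall i, (i < n)%N -> flat (X i.+1),
        exact_seq n (fun k => d k) &
        forall I : lmodType R^c, injective_module I -> tensor_exact_seq n d I].

(* Main.v *)
Require Import Defs.
From HB Require Import structures.
From mathcomp Require Import all_boot all_order all_algebra.
From mathcomp.classical Require Import boolp functions.
From mathcomp.multinomials Require Import freeg.

Set Implicit Arguments.
Unset Strict Implicit.
Unset Printing Implicit Defensive.

Import GRing.Theory.
Local Open Scope ring_scope.
Local Open Scope quotient_scope.

(** The projective modules [X_k] in the given sequence need not be finitely
    generated, so the point is to propagate the finiteness of [M] through the
    sequence.  Write [C_k] for the image of [d_k].  The claim is that [X_k / C_k]
    is always a retract of the quotient of [X_k] by a finitely generated
    submodule.  This is carried by the elementary property [compressible d_k]: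
    some endomorphism [e] of [X_k], congruent to the identity modulo [C_k], maps
    [C_k] into a finitely generated submodule of [C_k].

    For [C_n = M] one takes [e = 1].  Suppose [e] compresses the image of
    [d_(k+1)] into [Y], spanned by finitely many elements.  As [X_(k+1)] is
    projective, there are maps [p] from [X_(k+1)] to some [R^m] and [q] back with
    [q p = 1] on [Y] ([projective_fix_linear]).  Then [(1 - q p) e] vanishes on the image of
    [d_(k+1)], so by exactness of [Hom(-, X_(k+1))] it equals [g d_k] for some
    [g], and [1 - d_k g] compresses the image of [d_k] into the image of [d_k q]
    ([compressible_step]).

    Descending to [d_1], the same maps [e], [p], [q] present [M = X_0]: the map
    [d_0 q] from [R^m] to [M] can be arranged to be onto, and its kernel is
    generated by [p Y] and the image of [1 - p e q]
    ([compressible_finitely_presented]).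

    The same sequence witnesses that [M] is strongly Gorenstein flat.  Its terms
    are flat ([projective_flat]).  For exactness after tensoring with an
    injective [I], the key is [tensor_rV_image]: for a map [f] from [R^m] to
    [R^n], an element of [I (x) R^n] annihilated by every functional that kills
    [f] comes from [I (x) R^m].  This is the injectivity of
    [I (x) G -> Hom(Hom(G, R), I)] for the finitely presented [G = coker f].
    Given [t] in [I (x) X_(k+1)] killed by [d_k], every map out of [X_(k+1)]
    that extends along [d_k] kills [t]; hence [e t = q p e t], and [p e t] is
    annihilated by all functionals that kill [p Y], so [e t] comes from
    [I (x) X_(k+2)], as does [t - e t] ([compressible_tensor_exact]).
    Injectivity at the left end is the same argument for the finitely presented
    module [M] itself ([finitely_presented_tensor_inj]). *)

(** * Linear maps, submodules and finite free modules *)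

(** Bundles a function with a proof of its linearity, so that linear maps can be
    built inside proofs. *)
Definition linear_map (R : pzRingType) (A B : lmodType R) (f : A -> B)
  (fl : linear f) : A -> B := let _ := fl in f.

HB.instance Definition _ (R : pzRingType) (A B : lmodType R) (f : A -> B)
  (fl : linear f) := GRing.isLinear.Build R A B *:%R (linear_map fl) fl.

Section LinearAlgebra.
Variable R : pzRingType.

Section Submodule.
Variables (V : lmodType R) (P : V -> Prop).
Hypotheses (P0 : P 0) (PZD : forall a u v, P u -> P v -> P (a *: u + v)).

Let S : {pred V} := fun v => `[< P v >].

Let S_submod : submod_closed S.
Proof.
by split=> [|a u v /asboolP Pu /asboolP Pv]; apply/asboolP; [|exact: PZD].
Qed.

HB.instance Definition _ := GRing.isSubmodClosed.Build R V S S_submod.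
Let W := {v : V | v \in S}.
HB.instance Definition _ := SubChoice.copy W {v : V | v \in S}.
HB.instance Definition _ := [SubChoice_isSubLmodule of W by <:].

Lemma submodule_exists :
  exists (U : lmodType R) (i : {linear U -> V}),
    injective i /\ forall v, P v <-> exists w, i w = v.
Proof.
exists W, (val : W -> V); split; first exact: val_inj.
move=> v; split=> [Pv|[w <-]]; last by apply/asboolP; exact: (valP w).
have Sv : v \in S by apply/asboolP.
by exists (exist _ v Sv).
Qed.
End Submodule.

(** The inclusion [i] stands for a submodule of the image of [f], to which [g]
    descends because it kills the kernel of [f]. *)
Lemma linear_factor (A B U I : lmodType R) (f : {linear A -> B})
    (i : {linear U -> B}) (g : {linear A -> I}) :
    injective i -> (forall u, exists x, f x = i u) ->
    (forall x, f x = 0 -> g x = 0) ->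
  exists h : {linear U -> I}, forall x u, f x = i u -> h u = g x.
Proof.
move=> i_inj /choice[s fs] fg.
have gs x u : f x = i u -> g (s u) = g x.
  by move=> fx; apply/eqP; rewrite -subr_eq0 -linearB fg // linearB fs fx subrr.
have lin : linear (g \o s).
  by move=> a u v /=; rewrite (gs (a *: s u + s v)) ?linearP //= !fs.
by exists (linear_map lin) => x u /gs.
Qed.

(** As [g] kills the kernel of [f], it descends to the image of [f], and
    injectivity of [I] extends it from there to [B]. *)
Lemma injective_module_ext (A B I : lmodType R) (f : {linear A -> B})
    (g : {linear A -> I}) :
  injective_module I -> (forall x, f x = 0 -> g x = 0) ->
  exists h : {linear B -> I}, h \o f =1 g.
Proof.
move=> injI fg.
have [||U [i [i_inj imf]]] :=
  submodule_exists (V := B) (P := fun y => exists x, f x = y).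
- by exists 0; rewrite linear0.
- by move=> a _ _ [x <-] [y <-]; exists (a *: x + y); rewrite linearP.
have imi u : exists x, f x = i u by apply/imf; exists u.
have [h0 h0P] := linear_factor i_inj imi fg.
have [h hi] := injI _ _ i h0 i_inj; exists h => x /=.
have [|u iu] := (imf (f x)).1; first by exists x.
by rewrite -iu [h _]hi (h0P x).
Qed.

Lemma lincomb_linear (V : lmodType R) m (e : 'I_m -> V) :
  linear (fun v : 'rV[R]_m => \sum_i v 0 i *: e i).
Proof.
move=> a u v; rewrite scaler_sumr -big_split; apply: eq_bigr => i _.
by rewrite !mxE scalerDl scalerA.
Qed.

Definition lincomb (V : lmodType R) m (e : 'I_m -> V) : {linear 'rV[R]_m -> V} :=
  linear_map (lincomb_linear e).

Lemma lincomb_delta (V : lmodType R) m (e : 'I_m -> V) i :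
  lincomb e (delta_mx 0 i) = e i.
Proof.
rewrite /lincomb /= /linear_map (bigD1 i) //= mxE !eqxx scale1r big1 ?addr0 //.
by move=> j /negbTE ji; rewrite mxE ji andbF scale0r.
Qed.

Lemma linear_rV (V : lmodType R) m (f : {linear 'rV[R]_m -> V}) v :
  f v = \sum_i v 0 i *: f (delta_mx 0 i).
Proof.
rewrite [v in LHS]row_sum_delta linear_sum; apply: eq_bigr => i _.
by rewrite linearZ.
Qed.

Lemma coord_linear m (i : 'I_m) : linear (fun v : 'rV[R]_m => v 0 i : R^o).
Proof. by move=> a u v; rewrite !mxE. Qed.

Definition coord m (i : 'I_m) : {linear 'rV[R]_m -> R^o} :=
  linear_map (coord_linear i).

Lemma finitely_generated_rV (V : lmodType R) : finitely_generated V ->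
  exists m (g : {linear 'rV[R]_m -> V}), forall x, exists v, g v = x.
Proof.
move=> [m [e gen]]; exists m, (lincomb e) => x; have [a ->] := gen x.
exists (\row_i a i); rewrite /lincomb /= /linear_map.
by apply: eq_bigr => i _; rewrite mxE.
Qed.

Lemma projective_regular : projective (R^o : lmodType R).
Proof.
move=> A B f g fsurj; have [x fx] := fsurj (g (1 : R^o)).
have lin : linear (fun a : R^o => a *: x).
  by move=> a u v; rewrite scalerDl scalerA.
exists (linear_map lin) => a /=; rewrite /linear_map linearZ fx /= -linearZ /=.
by congr (g _); rewrite /GRing.scale /= mulr1.
Qed.

(** A local form of the dual basis lemma.  In place of the free module on [V],
    the proof splits the projection to [V] from the module of pairs of a
    coefficient function on [V] and the linear combination that it defines:
    this projection is linear and onto at once.  The components of the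
    splitting are coordinate functionals on [V]. *)
Lemma projective_fix_finite (V : lmodType R) (xs : seq V) : projective V ->
  exists m (p : {linear V -> 'rV[R]_m}) (q : {linear 'rV[R]_m -> V}),
    forall x, x \in xs -> q (p x) = x.
Proof.
move=> projV.
(* The terms [u.1 y *: y] vanish off a finite set and their sum is [u.2]; the
   quantifier over [s'] avoids a choice of the finite set. *)
pose graph (u : ((V -> R^o) * V)%type) := exists s : seq V, forall s' : seq V,
  uniq s' -> {subset s <= s'} -> \sum_(y <- s') (u.1 y : R) *: y = u.2.
have [||A [i [_ iP]]] := submodule_exists (P := graph).
- by exists [::] => s' _ _; rewrite big1 // => y _; rewrite scale0r.
- move=> a u v [s su] [t tv]; exists (s ++ t) => s' us' ss'.
  rewrite /= -(su s') // => [|y ys]; last by apply: ss'; rewrite mem_cat ys.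
  rewrite -(tv s') // => [|y yt]; last by apply: ss'; rewrite mem_cat yt orbT.
  rewrite scaler_sumr -big_split; apply: eq_bigr => y _ /=.
  by rewrite scalerDl scalerA.
have snd_lin : linear (fun w : A => (i w).2) by move=> a w w'; rewrite linearP.
have snd_surj y : exists w, linear_map snd_lin w = y.
  have [|w iw] := (iP ((fun z => (z == y)%:R), y)).1; last first.
    by exists w; rewrite /linear_map iw.
  exists [:: y] => s us ss; rewrite (bigD1_seq y) ?ss ?mem_head //= eqxx scale1r.
  by rewrite big1 ?addr0 // => z /negbTE ->; rewrite scale0r.
have [h hK] := projV _ _ _ idfun snd_surj.
pose f x := (i (h x)).1.
have /choice[s fs] x : exists s : seq V, forall s' : seq V,
    uniq s' -> {subset s <= s'} -> \sum_(y <- s') (f x y : R) *: y = x.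
  have [|s sP] := (iP (i (h x))).2; first by exists (h x).
  by exists s => s' us' ss'; rewrite -[RHS]hK; apply: sP.
pose ys := undup (flatten [seq s x | x <- xs]).
have p_lin : linear (fun x => \row_(j < size ys) f x ys`_j).
  by move=> a x y; apply/rowP => j; rewrite !mxE /f !linearP.
exists (size ys), (linear_map p_lin), (lincomb (fun j => ys`_j)) => x xxs.
rewrite -[RHS](fs x ys) ?undup_uniq // => [|y ysx]; last first.
  by rewrite mem_undup; apply/flatten_mapP; exists x.
rewrite (big_nth 0) big_mkord /lincomb /= /linear_map.
by apply: eq_bigr => j _; rewrite mxE.
Qed.

Lemma projective_fix_linear (V : lmodType R) n (f : {linear 'rV[R]_n -> V}) :
  projective V ->
  exists m (p : {linear V -> 'rV[R]_m}) (q : {linear 'rV[R]_m -> V}),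
    forall v, q (p (f v)) = f v.
Proof.
move=> /(projective_fix_finite (codom (fun i => f (delta_mx 0 i)))).
move=> [m [p [q qp]]]; exists m, p, q => v; rewrite (linear_rV f) !linear_sum.
by apply: eq_bigr => i _; rewrite !linearZ /= qp ?codom_f.
Qed.

End LinearAlgebra.

Arguments coord {R m} i.

(** * The functor I (x) - on linear maps *)

Notation tensorr g := (tensor_map idfun g).
Notation tensorl f := (tensor_map f idfun).

HB.instance Definition _ (R : pzRingType) (I J : lmodType R^c)
    (M N : lmodType R) (f : {linear I -> J}) (g : {linear M -> N}) :=
  GRing.isZmodMorphism.Build _ _ (tensor_map f g) (tensor_mapB f g).

Section Tensor.
Variable R : pzRingType.
Implicit Types (I J : lmodType R^c) (M N Q : lmodType R).

Lemma tensor_ind I M (P : tensor I M -> Prop) :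
    (forall x y, P (tens x y)) -> (forall s t, P s -> P t -> P (s - t)) ->
  forall t, P t.
Proof.
move=> Pt PB.
have P0 : P 0 by rewrite -(subrr (tens 0 0)); apply: PB.
have PN t : P t -> P (- t) by rewrite -sub0r; apply: PB.
have PD s t : P s -> P t -> P (s + t) by rewrite -{2}[t]opprK => ? /PN; apply: PB.
have PM t n : P t -> P (t *+ n).
  by move=> ?; elim: n => [|n IHn]; rewrite ?mulr0n // mulrS; apply: PD.
move=> t; rewrite -[t]reprK; move: (repr t) => u.
rewrite -(freeg_sumE u) raddf_sum; elim/big_ind: _ => // -[x y] _.
move: (coeff _ _) => k.
have -> : <<k *g (x, y)>> = <<(x, y)>> *~ k :> {freeg (I * M)%type / int}.
  by rewrite freegU_mulz intz.
rewrite raddfMz; case: k => k; first exact: PM (Pt _ _).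
by rewrite NegzE mulrNz; apply: PN; apply: PM (Pt _ _).
Qed.

Lemma tens0r I M (x : I) : tens x (0 : M) = 0.
Proof.
have [_ tD _] := @tens_balanced R I M.
by apply: (addrI (tens x (0 : M))); rewrite -tD !addr0.
Qed.

Lemma tens0l I M (y : M) : tens (0 : I) y = 0.
Proof.
have [tD _ _] := @tens_balanced R I M.
by apply: (addrI (tens (0 : I) y)); rewrite -tD !addr0.
Qed.

Lemma tensNl I M (x : I) (y : M) : tens (- x) y = - tens x y.
Proof.
have [tD _ _] := @tens_balanced R I M.
by apply/eqP; rewrite -addr_eq0 -tD addNr tens0l.
Qed.

Lemma tens_suml I M k (x : 'I_k -> I) (y : M) :
  tens (\sum_i x i) y = \sum_i tens (x i) y.
Proof.
have [tD _ _] := @tens_balanced R I M.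
by apply: (big_morph (fun x => tens x y)) => [a b|]; [exact: tD|exact: tens0l].
Qed.

Lemma tens_sumr I M k (x : I) (y : 'I_k -> M) :
  tens x (\sum_i y i) = \sum_i tens x (y i).
Proof.
have [_ tD _] := @tens_balanced R I M.
by apply: (big_morph (tens x)) => [a b|]; [exact: tD|exact: tens0r].
Qed.

Lemma tens_subr I M (x : I) (y z : M) : tens x (y - z) = tens x y - tens x z.
Proof.
have [_ tD _] := @tens_balanced R I M.
by apply/eqP; rewrite eq_sym subr_eq -tD subrK.
Qed.

Lemma tensor_sum I M (t : tensor I M) :
  exists k (x : 'I_k -> I) (y : 'I_k -> M), t = \sum_i tens (x i) (y i).
Proof.
elim/tensor_ind: t => [x y|_ _ [k [x [y ->]]] [l [x' [y' ->]]]].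
  by exists 1%N, (fun=> x), (fun=> y); rewrite big_ord1.
exists (k + l)%N; exists (fun i : 'I_(k + l) =>
  match fintype.split i with inl a => x a | inr b => - x' b end).
exists (fun i : 'I_(k + l) =>
  match fintype.split i with inl a => y a | inr b => y' b end).
rewrite big_split_ord -sumrN; congr (_ + _); apply: eq_bigr => i _.
  by have := unsplitK (inl i : 'I_k + 'I_l); rewrite /= => ->.
by have := unsplitK (inr i : 'I_k + 'I_l); rewrite /= => ->; rewrite tensNl.
Qed.

Lemma tensorr0 I M N (f : {linear M -> N}) :
  (forall y, f y = 0) -> forall t : tensor I M, tensorr f t = 0.
Proof.
move=> f0; apply: (@tensor_eq_additive _ _ _ _ (tensorr f) \0) => x y.
by rewrite /= tensor_mapE f0 tens0r.
Qed.

Lemma tensorrB I M N (f g h : {linear M -> N}) :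
  (forall y, h y = f y - g y) ->
  forall t : tensor I M, tensorr h t = tensorr f t - tensorr g t.
Proof.
move=> hE.
apply: (@tensor_eq_additive _ _ _ _ (tensorr h) (tensorr f \- tensorr g)) => x y.
by rewrite /= !tensor_mapE hE tens_subr.
Qed.

Lemma tensorr_comp I M N Q (f : {linear M -> N}) (g : {linear N -> Q})
    (h : {linear M -> Q}) :
  (forall y, h y = g (f y)) ->
  forall t : tensor I M, tensorr g (tensorr f t) = tensorr h t.
Proof.
move=> hE.
apply: (@tensor_eq_additive _ _ _ _ (tensorr g \o tensorr f) (tensorr h)) => x y.
by rewrite /= !tensor_mapE hE.
Qed.

Lemma tensor_mapC I J M N (f : {linear I -> J}) (g : {linear M -> N}) :
  forall t : tensor I M, tensorl f (tensorr g t) = tensorr g (tensorl f t).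
Proof.
apply: (@tensor_eq_additive _ _ _ _ (tensorl f \o tensorr g)
          (tensorr g \o tensorl f)) => x y.
by rewrite /= !tensor_mapE.
Qed.

(** The map [1 (x) phi] from [I (x) M] to [I (x) R = I]. *)
Definition contract I M (phi : {linear M -> R^o}) : tensor I M -> I :=
  tensor_lift (fun x y => (phi y : R^c) *: x).

Lemma contract_balanced I M (phi : {linear M -> R^o}) :
  balanced (fun (x : I) (y : M) => (phi y : R^c) *: x).
Proof.
split=> [x x' y|x y y'|x a y]; first exact: scalerDr.
  by rewrite linearD scalerDl.
by rewrite scalerA linearZ.
Qed.

HB.instance Definition _ I M (phi : {linear M -> R^o}) :=
  GRing.isZmodMorphism.Build _ _ (@contract I M phi)
    (tensor_liftB (contract_balanced I phi)).

Lemma contractE I M (phi : {linear M -> R^o}) (x : I) y :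
  contract phi (tens x y) = (phi y : R^c) *: x.
Proof. exact: (tensor_liftE (contract_balanced I phi)). Qed.

Lemma contract_tensorr I M N (f : {linear M -> N}) (phi : {linear N -> R^o})
    (psi : {linear M -> R^o}) :
  (forall y, psi y = phi (f y)) ->
  forall t : tensor I M, contract phi (tensorr f t) = contract psi t.
Proof.
move=> psiE.
apply: (@tensor_eq_additive _ _ _ _ (contract phi \o tensorr f) (contract psi)).
by move=> x y; rewrite /= tensor_mapE !contractE psiE.
Qed.

Lemma contract_tensorl I J M (f : {linear I -> J}) (phi : {linear M -> R^o}) :
  forall t : tensor I M, contract phi (tensorl f t) = f (contract phi t).
Proof.
apply: (@tensor_eq_additive _ _ _ _ (contract phi \o tensorl f)
          (f \o contract phi)) => x y.
by rewrite /= tensor_mapE !contractE linearZ.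
Qed.

Lemma tensor_rV I m (t : tensor I 'rV[R]_m) :
  t = \sum_j tens (contract (coord j) t) (delta_mx 0 j).
Proof.
have [tDl _ tM] := @tens_balanced R I 'rV[R]_m.
elim/tensor_ind: t => [x y|s t {1}-> {1}->].
  rewrite {1}[y]row_sum_delta tens_sumr; apply: eq_bigr => j _.
  by rewrite contractE tM.
rewrite -sumrB; apply: eq_bigr => j _.
by rewrite raddfB -tensNl -tDl.
Qed.

Lemma tensor_exact_comp I M N Q (f : {linear M -> N}) (g : {linear N -> Q})
  (t : tensor I M) : (forall y, g (f y) = 0) -> tensorr g (tensorr f t) = 0.
Proof.
by move=> gf; rewrite (tensorr_comp (h := g \o f)) // tensorr0.
Qed.

Lemma tensorr_surj I M N (f : {linear M -> N}) :
  (forall y, exists x, f x = y) ->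
  forall t : tensor I N, exists s, tensorr f s = t.
Proof.
move=> fsurj; elim/tensor_ind => [x y|_ _ [s <-] [t <-]].
  by have [z <-] := fsurj y; exists (tens x z); rewrite tensor_mapE.
by exists (s - t); rewrite raddfB.
Qed.

(** An element of [B (x) M] involves finitely many elements of [M], so it lives
    in a retract of some [B (x) R^m = B^m], where exactness is checked one
    coordinate at a time. *)
Lemma projective_flat M : projective M -> flat M.
Proof.
move=> projM A B C f g fg t; split=> [gt0|[s <-]]; last first.
  have gf0 x : g (f x) = 0 by apply/fg; exists x.
  elim/tensor_ind: s => [x y|s s' s0 s'0]; last by rewrite !raddfB /= s0 s'0 subrr.
  by rewrite !tensor_mapE gf0 tens0l.
have [k [x [y tE]]] := tensor_sum t.
have [m [p [q qpy]]] := projective_fix_finite (codom y) projM.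
have tqp : tensorr q (tensorr p t) = t.
  rewrite tE !raddf_sum; apply: eq_bigr => i _.
  by rewrite /= !tensor_mapE qpy ?codom_f.
pose u := tensorr p t.
have gu j : g (contract (coord j) u) = 0.
  by rewrite -contract_tensorl tensor_mapC gt0 !raddf0.
have /choice[z fz] j : exists z, f z = contract (coord j) u by apply/fg/gu.
exists (tensorr q (\sum_j tens (z j) (delta_mx 0 j))).
rewrite tensor_mapC -tqp; congr (tensorr q _); rewrite -/u [RHS]tensor_rV raddf_sum.
by apply: eq_bigr => j _; rewrite /= tensor_mapE fz.
Qed.

(** Identify [t] with a tuple of elements of [I].  Pairing with [t] is a map to
    [I] from the right module of functionals on [R^n]; by hypothesis it vanishes
    on those that kill [f], that is, on the kernel of the transpose of [f].  So
    it extends along the transpose to the functionals on [R^m], and the values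
    of the extension on the coordinate functionals give the preimage. *)
Lemma tensor_rV_image I m n (f : {linear 'rV[R]_m -> 'rV[R]_n})
    (t : tensor I 'rV[R]_n) :
  injective_module I ->
  (forall phi : {linear 'rV[R]_n -> R^o},
     (forall v, phi (f v) = 0) -> contract phi t = 0) ->
  exists s, tensorr f s = t.
Proof.
move=> injI t0; have [_ _ tM] := @tens_balanced R I 'rV[R]_n.
have fun_lin (c : 'rV[R^c]_n) :
    linear (fun v : 'rV[R]_n => \sum_j v 0 j * (c 0 j : R) : R^o).
  move=> a u v; rewrite /GRing.scale /= mulr_sumr -big_split.
  by apply: eq_bigr => j _; rewrite !mxE mulrDl mulrA.
pose functional c : {linear 'rV[R]_n -> R^o} := linear_map (fun_lin c).
have dual_lin :
    linear (fun c : 'rV[R^c]_n =>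
              \row_(i < m) functional c (f (delta_mx 0 i)) : 'rV[R^c]_m).
  move=> a c c'; apply/rowP => i; rewrite !mxE /functional /= /linear_map.
  rewrite (_ : a * _ = \sum_j f (delta_mx 0 i) 0 j * ((c 0 j : R) * a)).
    by rewrite -big_split; apply: eq_bigr => j _; rewrite !mxE /= mulrDr.
  by rewrite [LHS]mulr_suml; apply: eq_bigr => j _; rewrite mulrA.
have functional_delta c j : functional c (delta_mx 0 j) = c 0 j.
  rewrite /functional /= /linear_map (bigD1 j) //= mxE !eqxx mul1r big1 ?addr0 //.
  by move=> l /negbTE lj; rewrite mxE lj andbF mul0r.
have delta_functional j v : functional (delta_mx 0 j) v = v 0 j.
  rewrite /functional /= /linear_map (bigD1 j) //= mxE !eqxx mulr1 big1 ?addr0 //.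
  by move=> l /negbTE lj; rewrite mxE lj andbF mulr0.
pose pairing := lincomb (fun j => contract (coord j) t).
have pairingE c : pairing c = contract (functional c) t.
  rewrite [t in RHS]tensor_rV raddf_sum; apply: eq_bigr => j _.
  by rewrite /= contractE; congr (_ *: _); exact/esym/functional_delta.
have [|h hP] := injective_module_ext (f := linear_map dual_lin)
                  (g := pairing) injI.
  move=> c c0; rewrite pairingE; apply: t0 => v.
  rewrite (linear_rV f) linear_sum big1 // => i _.
  have fc0 : functional c (f (delta_mx 0 i)) = 0.
    by have := congr1 (fun w : 'rV[R^c]_m => w 0 i) c0; rewrite !mxE.
  by rewrite linearZ; apply: etrans (congr1 ( *%R (v 0 i)) fc0) (mulr0 _).
exists (\sum_i tens (h (delta_mx 0 i)) (delta_mx 0 i)).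
rewrite raddf_sum [RHS]tensor_rV.
transitivity (\sum_(i < m) \sum_(j < n)
    tens ((f (delta_mx 0 i) 0 j : R^c) *: h (delta_mx 0 i))
         (delta_mx 0 j : 'rV[R]_n)).
  apply: eq_bigr => i _.
  rewrite /= tensor_mapE /= [f _ in LHS]row_sum_delta tens_sumr.
  by apply: eq_bigr => j _; rewrite tM.
rewrite exchange_big; apply: eq_bigr => j _; rewrite -tens_suml; congr tens.
have -> : contract (coord j) t = pairing (delta_mx 0 j).
  by rewrite [RHS]lincomb_delta.
rewrite -hP /= linear_rV; apply: eq_bigr => i _.
by rewrite /linear_map mxE; congr (_ *: _); exact/esym/delta_functional.
Qed.
End Tensor.

(** * Compressing images into finitely generated submodules *)

Section Compression.
Variable R : pzRingType.
Implicit Types A B C : lmodType R.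

(** The cokernel of [d] is [A] modulo the image [C] of [d]; the endomorphism [e]
    makes it a retract of [A] modulo a finitely generated submodule of [C].
    Thus, for [A] projective, the cokernel is a retract of the sum of a finitely
    presented module and a free one. *)
Definition compressible A B (d : {linear B -> A}) :=
  exists (e : {linear A -> A}) m (b : {linear 'rV[R]_m -> B}),
    (forall x, exists z, x - e x = d z) /\
    (forall x, exists v, e (d x) = d (b v)).

Lemma compressible_fg A B (d : {linear B -> A}) :
  finitely_generated B -> compressible d.
Proof.
move=> /finitely_generated_rV[m [g gsurj]]; exists idfun, m, g; split=> x.
  by exists 0; rewrite linear0 subrr.
by have [v <-] := gsurj x; exists v.
Qed.

(** Since [(1 - q p) e] kills the image of [d'], it factors as [g d]; modulo the
    image of [d q] the map [d g] is then the identity on the image of [d]. *)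
Lemma compressible_step A B C (d' : {linear C -> B}) (d : {linear B -> A}) :
    projective B -> (forall z, d (d' z) = 0) ->
    (forall h : {linear B -> B}, (forall z, h (d' z) = 0) ->
       exists h' : {linear A -> B}, forall y, h' (d y) = h y) ->
  compressible d' -> compressible d.
Proof.
move=> projB dd' ext [e [k [b [e1 eb]]]].
have [m [p [q qp]]] := projective_fix_linear (d' \o b) projB.
have eE y : d (e y) = d y.
  have [z /(congr1 d)] := e1 y; rewrite linearB dd' => /eqP.
  by rewrite subr_eq0 => /eqP.
have [|g gE] := ext (e \- (q \o p \o e)).
  by move=> z /=; have [v ->] := eb z; rewrite [q _]qp subrr.
exists (idfun \- (d \o g)), m, q; split=> x.
  by exists (g x); rewrite /= opprB addrC subrK.
exists (p (e x)).
by rewrite /= gE /= linearB eE opprB addrC subrK.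
Qed.

(** Choose [p] and [q] so that [q p] is the identity on the generators of
    [e (im d')] and on the images under [e] of lifts of generators of [A].  Then
    [q p e = e], whence [d q] is onto.  If [d q y = 0] then [e q y] lies in the
    span of [d' b], so [y = p e q y + (y - p e q y)] lies in the submodule
    generated by [p d' b] and the image of [1 - p e q]. *)
Lemma compressible_finitely_presented A B C (d' : {linear C -> B})
    (d : {linear B -> A}) :
    projective B -> exact_at d' d -> (forall y, exists x, d x = y) ->
    finitely_generated A -> compressible d' ->
  finitely_presented A.
Proof.
move=> projB ex dsurj /finitely_generated_rV[l [a asurj]] [e [k [b [e1 eb]]]].
have dd' z : d (d' z) = 0 by apply/ex; exists z.
have /choice[x0 dx0] (i : 'I_l) : exists x, d x = a (delta_mx 0 i) by exact: dsurj.
pose c := e \o lincomb x0.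
have eE x : d (e x) = d x.
  have [z /(congr1 d)] := e1 x; rewrite linearB dd' => /eqP.
  by rewrite subr_eq0 => /eqP.
have dc v : d (c v) = a v.
  rewrite /= eE (linear_rV a) linear_sum; apply: eq_bigr => i _.
  by rewrite linearZ dx0.
pose w := (d' \o b \o lsubmx) \+ (c \o rsubmx).
have [m [p [q qp]]] := @projective_fix_linear R B (k + l) w projB.
have qpb v : q (p (d' (b v))) = d' (b v).
  by have := qp (row_mx v 0); rewrite /w /= row_mxKl row_mxKr !linear0 addr0.
have qpe x : q (p (e x)) = e x.
  have [v av] := asurj (d x).
  have [z dz] : exists z, d' z = x - lincomb x0 v.
    by apply/ex; rewrite linearB -(eE (lincomb x0 v)) [d (e _)]dc av subrr.
  have [v' ev'] := eb z.
  have := qp (row_mx v' v); rewrite /w /= row_mxKl row_mxKr -ev' dz.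
  by rewrite linearB subrK.
pose f := (p \o d' \o b \o lsubmx) \+ ((idfun \- (p \o e \o q)) \o rsubmx).
exists (k + m)%N, m, (f : {linear 'rV[R]_(k + m) -> 'rV[R]_m}), (d \o q).
split=> [y|y]; last by have [x <-] := dsurj y; exists (p (e x)); rewrite /= qpe eE.
split=> [/= /ex[z dz]|[u <-]]; last first.
  by rewrite /f /= linearD linearB /= qpb qpe linearD linearB eE dd' subrr addr0.
have [v ev] := eb z; exists (row_mx v y).
by rewrite /f /= row_mxKl row_mxKr -dz ev addrC subrK.
Qed.

(** Every map out of [B] that kills the image of [d'] factors through [d], hence
    kills [t] after tensoring.  Applied to [(1 - q p) e] and to [phi p e], for
    functionals [phi] that kill [p d' b], this puts [e t] in the image of
    [I (x) d'].  The element [t - e t] is there because [1 - e] has values in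
    the image of [d']. *)
Lemma compressible_tensor_exact A B C (d' : {linear C -> B})
    (d : {linear B -> A}) (I : lmodType R^c) :
    projective B -> (forall z, d (d' z) = 0) ->
    (forall Q, projective Q ->
       forall h : {linear B -> Q}, (forall z, h (d' z) = 0) ->
       exists h' : {linear A -> Q}, forall y, h' (d y) = h y) ->
    compressible d' -> injective_module I ->
  exact_at (tensor_map (idfun : {linear I -> I}) d') (tensorr d).
Proof.
move=> projB dd' ext [e [k [b [e1 eb]]]] injI t.
split=> [dt0|[s <-]]; last exact: tensor_exact_comp.
have [m [p [q qp]]] := projective_fix_linear (d' \o b) projB.
have kill (Q : lmodType R) (h : {linear B -> Q}) : projective Q ->
    (forall z, h (d' z) = 0) -> tensorr h t = 0.
  move=> projQ /(ext Q projQ)[h' h'E].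
  by rewrite -(tensorr_comp (f := d) (g := h')) // dt0 raddf0.
have etE : tensorr e t = tensorr q (tensorr (p \o e) t).
  rewrite (tensorr_comp (h := q \o p \o e)) //; apply/eqP; rewrite -subr_eq0.
  rewrite -(tensorrB (h := e \- (q \o p \o e))) // kill // => z /=.
  by have [v ->] := eb z; rewrite [q _]qp subrr.
have [|s sE] := @tensor_rV_image R I _ _ (p \o d' \o b) (tensorr (p \o e) t) injI.
  move=> phi phi0; rewrite (contract_tensorr (psi := phi \o p \o e)) //.
  have [|h hE] := ext _ (@projective_regular R) (phi \o p \o e).
    by move=> z /=; have [v ->] := eb z; exact: phi0.
  by rewrite -(contract_tensorr (f := d) (phi := h)) // dt0 raddf0.
have /(_ t)[r rE] (u : tensor I B) : exists r, tensorr d' r = u - tensorr e u.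
  elim/tensor_ind: u => [x y|u1 u2 [r1 r1E] [r2 r2E]].
    have [z ez] := e1 y; exists (tens x z).
    by rewrite !tensor_mapE /= -ez tens_subr.
  exists (r1 - r2); rewrite !raddfB /= r1E r2E !opprB.
  by rewrite [RHS]addrACA opprK; congr (_ + _); apply: addrC.
exists (r + tensorr b s); rewrite raddfD /= rE (tensorr_comp (h := d' \o b)) //.
rewrite etE -sE (tensorr_comp (g := q) (h := d' \o b)) ?subrK // => v.
by rewrite [RHS]qp.
Qed.

(** A functional killing the relations of [A] is a functional on [A], so it
    extends to [B] and kills every [t] with [d t = 0]. *)
Lemma finitely_presented_tensor_inj A B (d : {linear A -> B}) (I : lmodType R^c) :
    finitely_presented A ->
    (forall h : {linear A -> R^o}, exists h' : {linear B -> R^o},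
       forall x, h' (d x) = h x) ->
    injective_module I ->
  injective (tensor_map (idfun : {linear I -> I}) d).
Proof.
move=> [k [m [f [g [fg gsurj]]]]] ext injI t t' tt'.
apply/eqP; rewrite -subr_eq0; apply/eqP.
have {tt'} : tensorr d (t - t') = 0 by rewrite raddfB /= tt' subrr.
move: (t - t') => {t'} {}t dt0.
have [u ut] := tensorr_surj gsurj t; rewrite -ut.
have gf v : g (f v) = 0 by apply/fg; exists v.
have [|s <-] := tensor_rV_image (f := f) (t := u) injI; last first.
  exact: tensor_exact_comp.
move=> phi phi0.
have [h hE] : exists h : {linear A -> R^o}, forall v, h (g v) = phi v.
  have [|v /fg[w <-]|h hP] := @linear_factor _ _ _ _ _ g idfun phi (@inj_id A).
  - exact: gsurj.
  - exact: phi0.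
  - by exists h => v; apply: hP.
rewrite -(contract_tensorr (f := g) (phi := h)) // ut.
have [h' h'E] := ext h.
by rewrite -(contract_tensorr (f := d) (phi := h')) // dt0 raddf0.
Qed.
End Compression.

Theorem proposition4p7 (R : pzRingType) (n : nat) (hn : (0 < n)%N)
    (M : lmodType R) (hfg : finitely_generated M) (hM : SG_projective n M) :
  finitely_presented M /\ SG_flat n M.
Proof.
have [X [d [[X0 Xn] projX [d0surj dex dninj] homex]]] := hM.
have dd k : (k < n)%N -> forall z, d k (d k.+1 z) = 0.
  by move=> /dex exk z; apply/exk; exists z.
have ext k Q : (k < n)%N -> projective Q -> forall h : {linear X k.+1 -> Q},
    (forall z, h (d k.+1 z) = 0) ->
    exists h' : {linear X k -> Q}, forall y, h' (d k y) = h y.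
  by move=> kn /homex[_ /(_ k kn) exk _] h /exk.
have compr k : (k <= n)%N -> compressible (d k).
  move=> kn; have [j kjn] : exists j, (k + j)%N = n.
    by exists (n - k)%N; rewrite subnKC.
  elim: j k kjn {kn} => [|j IHj] k; first rewrite addn0 => ->.
    by apply: compressible_fg; rewrite Xn.
  rewrite addnS -addSn => kjn; have kn : (k < n)%N by rewrite -kjn leq_addr.
  apply: compressible_step (IHj _ kjn); [exact: projX|exact: dd|].
  exact/ext/projX.
have fpM : finitely_presented M.
  rewrite -X0; apply: (compressible_finitely_presented (d' := d 1%N)).
  - exact: projX.
  - exact: dex.
  - exact: d0surj.
  - by rewrite X0.
  - exact: compr.
split=> //; exists X, d; split=> // [i ni|I injI]; first exact/projective_flat/projX.
split=> [|k kn|]; first exact: tensorr_surj.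
  apply: compressible_tensor_exact => //; [exact: projX|exact: dd| |exact: compr].
  by move=> Q; apply: ext.
apply: finitely_presented_tensor_inj => //; first by rewrite Xn.
by have [_ _ ext1] := homex _ (@projective_regular R).
Qed.
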